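(* Consider the two-level Exponential–Gaussian generalized random energy model described in the context, with weights $a_1,a_2>0$ and limiting proportions $p_1,p_2>0$. If $\frac{a_2}{a_1}\ge\sqrt{2\log2}$, then almost surely $$\lim_{N\to\infty}\frac1N\log Z_N(\beta)=\begin{cases}\log2+\frac12\beta^2a_2^2&\text{if }\beta\le\frac{\sqrt{2\log2}}{a_2},\\ \beta a_2\sqrt{2\log2}&\text{if }\beta>\frac{\sqrt{2\log2}}{a_2}.\end{cases}$$
   Context: Model: for each $N\ge2$ let $k(1,N),k(2,N)\ge1$ be integers with $k(1,N)+k(2,N)=N$ and $\frac{k(i,N)}N\to p_i>0$. Write $\sigma\in\{+1,-1\}^N$ as $\sigma_1\sigma_2$ with $\sigma_i\in\{+1,-1\}^{k(i,N)}$. For each $N$ the random variables $\xi(\sigma_1)$, $\xi(\sigma_1\sigma_2)$ (over all $\sigma_1,\sigma_2$) are independent; each $\xi(\sigma_1)$ has the two-sided exponential density $\frac12e^{-|x|}$ and each $\xi(\sigma_1\sigma_2)$ is Gaussian $\mathcal{N}(0,N)$ (variance $N$). All $N$ are on one probability space. $H_N(\sigma)=a_1\xi(\sigma_1)+a_2\xi(\sigma_1\sigma_2)$, $Z_N(\beta)=\sum_\sigma e^{-\beta H_N(\sigma)}$, $\beta>0$. *)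

(* Defs.v *)
From HB Require Import structures.
From mathcomp Require Import all_boot all_order all_algebra.
From mathcomp Require Import all_classical all_reals all_analysis.

Set Implicit Arguments.
Unset Strict Implicit.
Unset Printing Implicit Defensive.

Import Order.TTheory GRing.Theory Num.Theory.
Import numFieldNormedType.Exports.

Local Open Scope classical_set_scope.
Local Open Scope ring_scope.

(* {+1,-1}^n, with [true] standing for +1 and [false] for -1; the spin values
   serve only as indices, so no arithmetic on them is needed. *)
Definition spins (n : nat) := {ffun 'I_n -> bool}.

Definition has_density d (T : measurableType d) (R : realType)
    (P : probability T R) (X : {RV P >-> R}) (f : R -> R) : Prop :=
  forall A : set R, measurable A ->
    distribution P X A = (\int[lebesgue_measure]_(x in A) (f x)%:E)%E.

(* [normal_prob] takes the standard deviation as its second parameter. *)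
Definition is_gaussian d (T : measurableType d) (R : realType)
    (P : probability T R) (X : {RV P >-> R}) (mean variance : R) : Prop :=
  forall A : set R, measurable A ->
    distribution P X A = normal_prob mean (Num.sqrt variance) A.

Definition mutually_independent d (T : measurableType d) (R : realType)
    (P : probability T R) (I : finType) (X : I -> {RV P >-> R}) : Prop :=
  forall (J : {set I}) (A : I -> set R),
    (forall i, i \in J -> measurable (A i)) ->
    P (\bigcap_(i in [set` J]) (X i @^-1` A i)) =
    (\prod_(i in J) P (X i @^-1` A i))%E.

(* The energies of both levels gathered in one family, so that independence
   holds within each level and across the two levels. *)
Definition all_energies d (T : measurableType d) (R : realType)
    (P : probability T R) (n1 n2 : nat) (xi1 : spins n1 -> {RV P >-> R})
    (xi2 : spins n1 -> spins n2 -> {RV P >-> R})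
    (i : spins n1 + spins n1 * spins n2) : {RV P >-> R} :=
  match i with
  | inl s1 => xi1 s1
  | inr s => xi2 s.1 s.2
  end.

Definition hamiltonian d (T : measurableType d) (R : realType)
    (P : probability T R) (n1 n2 : nat) (a1 a2 : R)
    (xi1 : spins n1 -> {RV P >-> R})
    (xi2 : spins n1 -> spins n2 -> {RV P >-> R})
    (w : T) (s : spins n1 * spins n2) : R :=
  a1 * xi1 s.1 w + a2 * xi2 s.1 s.2 w.

(* A configuration in {+1,-1}^(n1 + n2) is the pair of its two blocks. *)
Definition partition_function d (T : measurableType d) (R : realType)
    (P : probability T R) (n1 n2 : nat) (a1 a2 : R)
    (xi1 : spins n1 -> {RV P >-> R})
    (xi2 : spins n1 -> spins n2 -> {RV P >-> R}) (beta : R) (w : T) : R :=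
  \sum_(s : spins n1 * spins n2) expR (- beta * hamiltonian a1 a2 xi1 xi2 w s).

(* Main.v *)
Require Import Defs.
From HB Require Import structures.
From mathcomp Require Import all_boot all_order all_algebra.
From mathcomp Require Import all_classical all_reals all_analysis.
From mathcomp Require Import measurable_realfun.
From mathcomp Require Import ring lra.

Set Implicit Arguments.
Unset Strict Implicit.
Unset Printing Implicit Defensive.

Import Order.TTheory GRing.Theory Num.Theory.
Import numFieldNormedType.Exports.

Local Open Scope classical_set_scope.
Local Open Scope ring_scope.

(** Under [a2 / a1 >= sqrt (2 ln 2)] the exponential level is too weak to
    compete: putting energy into it costs more entropy than it gains, so the
    limit is that of a pure Gaussian random energy model of strength [a2], with
    critical inverse temperature [sqrt (2 ln 2) / a2].  Two one-sided bounds,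
    valid almost surely up to any fixed error, are proved separately; a
    countable intersection over the errors [1 / (n + 1)] then gives the limit.
    Both bounds rest on the easy half of the Borel-Cantelli lemma
    ([ae_eventually_notin]), and therefore on probability estimates at each
    fixed volume [N].

    Upper bound ([ae_pressure_le]).  If [theta * a1 < 1], the exponential level
    contributes only a bounded factor to the mean of the partition function at
    [theta], whence
    [E Z_N(theta) <= C 2^N exp (theta^2 a2^2 N / 2)], and Markov's inequality
    makes this an almost sure bound.  For [beta] above [theta], the inequality
    between the l^1 and l^p norms gives
    [ln Z(beta) <= (beta / theta) ln Z(theta)].  One takes [theta = beta] below
    the critical value and lets [theta] increase to it otherwise
    ([limit_upper_param]); the condition on [a2 / a1] says precisely that
    [theta * a1 < 1] for every subcritical [theta].

    Lower bound ([ae_pressure_ge]).  Count the configurations whose first-level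
    variable is nonpositive, an event of fixed probability [b], and whose
    Gaussian variable is at most [- y N], an event of probability
    [q ~ exp (- y^2 N / 2)].  The count has mean [2^N b q], and its relative
    variance is at most [1 / (2^k1 b) + 1 / (2^N b q)]
    ([level_event_count_le]): the first term comes from pairs of configurations
    sharing their first block, the second from the diagonal.  Both decay
    exponentially as soon as [y^2 / 2 < ln 2], since [k1] grows linearly.  Each
    counted configuration contributes at least [exp (beta a2 y N)], so the
    liminf is at least [ln 2 - y^2 / 2 + beta a2 y]; the supremum over the
    admissible [y] is the stated limit ([limit_lower_param]). *)

(** * Integrals against densities and independent variables *)

(** The Radon-Nikodym derivative of [nu] agrees with [f] almost everywhere,
    because both have the same integral over every measurable set. *)
Lemma ge0_integral_density (d : measure_display) (T : measurableType d)
    (R : realType) (mu : {sigma_finite_measure set T -> \bar R})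
    (nu : {finite_measure set T -> \bar R}) (f g : T -> \bar R) :
  measurable_fun [set: T] f -> (forall x, (0 <= f x)%E) ->
  (forall A, measurable A -> nu A = \int[mu]_(x in A) f x)%E ->
  measurable_fun [set: T] g -> (forall x, (0 <= g x)%E) ->
  (\int[nu]_x g x = \int[mu]_x (g x * f x))%E.
Proof.
move=> mf f0 nuf mg g0.
have nudom : nu `<< mu.
  apply/null_content_dominatesP => A mA muA0; rewrite nuf//.
  by apply: null_set_integral => //; exact: measurable_funTS.
rewrite -(Radon_Nikodym_SigmaFinite.change_of_variables nudom)//.
have intf : mu.-integrable setT f.
  apply/integrableP; split => //.
  under eq_integral do rewrite gee0_abs//.
  by rewrite -nuf// ltey_eq fin_num_measure.
apply: ae_eq_integral => //.
- apply: emeasurable_funM => //.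
  exact: measurable_int (Radon_Nikodym_SigmaFinite.f_integrable nudom).
- exact: emeasurable_funM.
- apply: ae_eqe_mul2l; apply: integral_ae_eq => //.
  + exact: Radon_Nikodym_SigmaFinite.f_integrable.
  + by move=> E _ mE; rewrite -nuf// -Radon_Nikodym_SigmaFinite.f_integral.
Qed.

(** The law of the pair [(X, Y)] agrees with the product of the two laws on
    rectangles, hence everywhere; Tonelli's theorem then splits the integral. *)
Lemma ge0_integral_indep (d : measure_display) (T : measurableType d)
    (R : realType) (P : probability T R) (X Y : {RV P >-> R}) (f g : R -> R) :
  (forall A B : set R, measurable A -> measurable B ->
     P (X @^-1` A `&` Y @^-1` B) = P (X @^-1` A) * P (Y @^-1` B))%E ->
  measurable_fun setT f -> measurable_fun setT g ->
  (forall x, 0 <= f x) -> (forall x, 0 <= g x) ->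
  (\int[P]_w (f (X w) * g (Y w))%:E =
   (\int[P]_w (f (X w))%:E) * (\int[P]_w (g (Y w))%:E))%E.
Proof.
move=> XY mf mg f0 g0.
pose h w := (X w, Y w).
have mh : measurable_fun setT h by exact: measurable_fun_pair.
pose H : {mfun T >-> (R * R)%type} := mfun_Sub (mem_set mh).
pose F (z : R * R) : \bar R := (f z.1 * g z.2)%:E.
have mF : measurable_fun setT F.
  apply/measurable_EFinP; apply: measurable_funM.
    by apply: measurableT_comp.
  by apply: measurableT_comp.
have F0 z : (0 <= F z)%E by rewrite lee_fin mulr_ge0.
transitivity (\int[distribution P H]_z F z)%E.
  by rewrite ge0_integral_distribution.
transitivity (\int[(distribution P X \x distribution P Y)%E]_z F z)%E.
  apply: eq_measure_integral => A mA _; apply: esym.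
  by apply: product_measure_unique => // A1 B1 mA1 mB1; exact: XY.
rewrite fubini_tonelli1//= /fubini_F/= /F/=.
under eq_integral => x _.
  under eq_integral do rewrite EFinM.
  rewrite ge0_integralZl//; last 3 first.
    by apply/measurable_EFinP.
    by move=> y _; rewrite lee_fin.
    by rewrite lee_fin.
  over.
rewrite ge0_integralZr//; last 3 first.
- by apply/measurable_EFinP.
- by move=> y _; rewrite lee_fin.
- by apply: integral_ge0 => y _; rewrite lee_fin.
by rewrite !ge0_integral_distribution//; exact/measurable_EFinP.
Qed.

Lemma ge0_expectation_density (d : measure_display) (T : measurableType d)
    (R : realType) (P : probability T R) (X : {RV P >-> R}) (f g : R -> R) :
  measurable_fun [set: R] f -> (forall x, 0 <= f x) -> has_density X f ->
  measurable_fun [set: R] g -> (forall x, 0 <= g x) ->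
  (\int[P]_w (g (X w))%:E = \int[lebesgue_measure]_x (g x * f x)%:E)%E.
Proof.
move=> mf f0 Xf mg g0.
(* The Lebesgue measure lives on a differently displayed copy of the Borel
   sigma-algebra, so the law of [X] is first transported there. *)
have mX : @measurable_fun _ _ T (measurableTypeR R) setT X.
  exact: (@measurable_funPT _ _ _ _ X).
pose Y : {mfun T >-> measurableTypeR R} := @mfun_Sub _ _ T (measurableTypeR R) _ (mem_set mX).
transitivity (\int[distribution P Y]_x (g x)%:E)%E.
  rewrite ge0_integral_distribution//.
  exact/measurable_EFinP.
rewrite (@ge0_integral_density _ (measurableTypeR R) _
  (@lebesgue_measure R) (distribution P Y) (EFin \o f))//;
  exact/measurable_EFinP.
Qed.

(** * Moments, tails and null sets *)

Lemma measurable_expRM (R : realType) (t : R) :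
  measurable_fun [set: R] (fun x : R => expR (t * x)).
Proof. by apply: measurableT_comp => //; exact: mulrl_measurable. Qed.

(** Completing the square turns the exponentially tilted centred density into a
    constant times the density with mean [t * v], which integrates to one. *)
Lemma gaussian_mgf (d : measure_display) (T : measurableType d) (R : realType)
    (P : probability T R) (X : {RV P >-> R}) (v t : R) :
  0 < v -> is_gaussian X 0 v ->
  (\int[P]_w (expR (t * X w))%:E = (expR (2^-1 * t ^+ 2 * v))%:E)%E.
Proof.
move=> v0 gX.
have s0 : Num.sqrt v != 0 by rewrite gt_eqF// sqrtr_gt0.
have mexp : measurable_fun [set: R] (fun x : R => (expR (t * x))%:E).
  by apply/measurable_EFinP; exact: measurable_expRM.
rewrite (ge0_expectation_density _ _ gX (measurable_expRM t)); last 3 first.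
- exact: measurable_normal_pdf.
- exact: normal_pdf_ge0.
- by move=> x; exact: expR_ge0.
transitivity (\int[lebesgue_measure]_x
   ((expR (2^-1 * t ^+ 2 * v))%:E * (normal_pdf (t * v) (Num.sqrt v) x)%:E))%E.
  apply: eq_integral => x _; rewrite -!EFinM !normal_pdfE//; congr EFin.
  rewrite mulrCA [RHS]mulrCA /normal_fun -!expRD !sqr_sqrtr ?ltW//.
  by congr (_ * expR _); field; rewrite gt_eqF.
rewrite ge0_integralZl// ?integral_normal_pdf ?mule1 ?lee_fin ?expR_ge0//.
- by apply/measurable_EFinP; exact: measurable_normal_pdf.
- by move=> x _; rewrite lee_fin normal_pdf_ge0.
Qed.

(** By symmetry this is twice the integral over the half line, where the
    integrand is [r^-1] times the exponential density of rate [r]. *)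
Lemma integral_expRN_norm (R : realType) (r : R) : 0 < r ->
  (\int[lebesgue_measure]_x (expR (- (r * `|x|)))%:E = (2 / r)%:E)%E.
Proof.
move=> r0; rewrite ge0_symfun_integralT.
- rewrite EFinM; congr (_ * _)%E.
  rewrite -[RHS]mule1 -(@integral_exponential_pdf R r)// -ge0_integralZl//; last 3 first.
  + by apply/measurable_EFinP; exact: measurable_exponential_pdf.
  + by move=> x _; rewrite lee_fin exponential_pdf_ge0// ltW.
  + by rewrite lee_fin invr_ge0 ltW.
  have -> : [set x : R | 0 <= x] = `[0, +oo[%classic.
    by apply/seteqP; split => x /=; rewrite in_itv/= andbT.
  rewrite [LHS]integral_mkcond; apply: eq_integral => x _.
  rewrite patchE; case: ifPn => [|/negP].
    rewrite inE/= in_itv/= andbT => x0.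
    rewrite exponential_pdfE// -EFinM; congr EFin.
    by rewrite mulrA mulVf ?gt_eqF// mul1r ger0_norm// mulNr.
  rewrite inE/= in_itv/= andbT => /negP; rewrite -ltNge => x0.
  by rewrite lt0_exponential_pdf// mule0.
- by move=> x; exact: expR_ge0.
- move=> x; apply: continuous_comp; last exact: continuous_expR.
  apply: (@continuousN _ R^o); apply: (@continuousM _ R^o).
    exact: cst_continuous.
  exact: norm_continuous.
- by move=> x /=; rewrite normrN.
Qed.

(** Since [t x - |x| <= - (1 - |t|) |x|].  This bound is
    the same for all volumes, hence invisible in the free energy. *)
Lemma laplace_mgf_le (d : measure_display) (T : measurableType d) (R : realType)
    (P : probability T R) (X : {RV P >-> R}) (t : R) :
  `|t| < 1 -> has_density X (fun x : R => 2^-1 * expR (- `|x|)) ->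
  (\int[P]_w (expR (t * X w))%:E <= ((1 - `|t|)^-1)%:E)%E.
Proof.
move=> t1 dX.
have mnorm (r : R) : measurable_fun [set: R] (fun x : R => expR (- (r * `|x|))).
  apply: measurableT_comp => //; apply: measurableT_comp => //.
  by apply: measurable_funM => //; exact: measurableT_comp.
have mexp := @measurable_expRM R t.
have mdens : measurable_fun [set: R] (fun x : R => 2^-1 * expR (- `|x|)).
  apply: measurable_funM => //.
  by under eq_fun do rewrite -(mul1r `|_|); exact: mnorm.
rewrite (ge0_expectation_density mdens _ dX mexp); last 2 first.
- by move=> x; rewrite mulr_ge0 ?expR_ge0.
- by move=> x; exact: expR_ge0.
apply: (@le_trans _ _ (\int[lebesgue_measure]_x
    (2^-1%:E * (expR (- ((1 - `|t|) * `|x|)))%:E))%E).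
  apply: ge0_le_integral => //.
  - by apply/measurable_EFinP; exact: measurable_funM.
  - by apply: emeasurable_funM => //; apply/measurable_EFinP; exact: mnorm.
  - move=> x _; rewrite -EFinM lee_fin mulrCA ler_pM2l// -expRD ler_expR.
    have := ler_norm (t * x); rewrite normrM; lra.
rewrite ge0_integralZl//; last first.
  by apply/measurable_EFinP; exact: mnorm.
rewrite integral_expRN_norm ?subr_gt0// -EFinM lee_fin.
by rewrite mulrA mulVf// mul1r.
Qed.

Lemma ge0_markov (d : measure_display) (T : measurableType d) (R : realType)
    (P : probability T R) (Z : T -> R) (a : R) :
  measurable_fun [set: T] Z -> (forall w, 0 <= Z w) -> 0 < a ->
  (P [set w | (a <= Z w)%R] <= (a^-1)%:E * \int[P]_w (Z w)%:E)%E.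
Proof.
move=> mZ Z0 a0.
have mA : measurable [set w | a <= Z w].
  have := mZ measurableT `[a, +oo[%classic (measurable_itv _).
  rewrite setTI; congr measurable; apply/seteqP.
  by split => w /=; rewrite in_itv/= andbT.
have mEZ : measurable_fun [set: T] (EFin \o Z) by exact/measurable_EFinP.
rewrite muleC lee_pdivlMr// muleC -integral_cst//.
apply: (@le_trans _ _ (\int[P]_(w in [set w | (a <= Z w)%R]) (Z w)%:E)%E).
  apply: ge0_le_integral => //.
  - by move=> w _; rewrite lee_fin ltW.
  - exact: measurable_funS mEZ.
by apply: ge0_subset_integral => // w _; rewrite lee_fin.
Qed.

(** Exponentially small probabilities are summable, so the points lying in
    infinitely many of the sets form a null set. *)
Lemma ae_eventually_notin (d : measure_display) (T : measurableType d)
    (R : realType) (P : probability T R) (F : nat -> set T) (K c : R) :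
  (forall n, measurable (F n)) -> 0 <= K -> 0 < c ->
  (\forall n \near \oo, (P (F n) <= (K * expR (- (c * n%:R)))%:E)%E) ->
  {ae P, forall w, \forall n \near \oo, ~ F n w}.
Proof.
move=> mF K0 c0 [n0 _ Fn0].
(* The bound only holds from [n0] on, so the earlier sets are emptied, which
   does not change the limsup but makes the whole series geometric. *)
pose G n := if (n0 <= n)%N then F n else set0.
have mG n : measurable (G n) by rewrite /G; case: ifP.
exists (lim_sup_set G); split.
- by apply: bigcap_measurable => // k _; exact: bigcup_measurable.
- apply: lim_sup_set_cvg0 => //.
  pose z := expR (- c).
  have z0 : 0 < z by exact: expR_gt0.
  have z1 : z < 1 by rewrite expR_lt1 oppr_lt0.
  apply: (@le_lt_trans _ _ (K * (1 - z)^-1)%:E); last exact: ltry.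
  apply: lime_le; first by apply: is_cvg_nneseries => n _ _; exact: measure_ge0.
  apply: nearW => n.
  apply: (@le_trans _ _ (\sum_(0 <= i < n) (K * z ^+ i)%:E)%E).
    apply: lee_sum => i _; rewrite /G; case: ifPn => [ni|_].
      apply: le_trans (Fn0 _ ni) _; rewrite lee_fin /z -expRM_natr.
      by rewrite mulNr.
    by rewrite measure0 lee_fin mulr_ge0 ?exprn_ge0 ?(ltW z0).
  rewrite sumEFin lee_fin.
  by apply: (@geometric_le_lim _ n K z K0 z0); rewrite gtr0_norm.
- move=> w /= nw n _.
  apply: contrapT => nG; apply: nw.
  exists (maxn n n0) => // j /=; rewrite geq_max => /andP[nj n0j] Fj.
  by apply: nG; exists j => //; rewrite /G n0j.
Qed.

(** The density is at least its value at [- (a + 1)] on the unit interval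
    [[- a - 1, - a]]; on the exponential scale this loses nothing. *)
Lemma normal_prob_tail_ge (R : realType) (s a : R) : 0 < s -> 0 <= a ->
  ((normal_pdf 0 s (a + 1)%R)%:E <= normal_prob 0 s `]-oo, (- a)%R])%E.
Proof.
move=> s0 a0; rewrite /normal_prob.
have mpdf : measurable_fun [set: R] (EFin \o normal_pdf 0 s).
  by apply/measurable_EFinP; exact: measurable_normal_pdf.
apply: (@le_trans _ _ (\int[lebesgue_measure]_(x in `[(- a - 1)%R, (- a)%R])
    (cst (normal_pdf 0 s (a + 1)%R)%:E x))%E).
  rewrite integral_cst//= lebesgue_measure_itv/= lte_fin ifT; last by lra.
  by rewrite -EFinB -EFinM lee_fin opprB addrCA subrr addr0 mulr1.
apply: (@le_trans _ _ (\int[lebesgue_measure]_(x in `[(- a - 1)%R, (- a)%R])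
    (normal_pdf 0 s x)%:E)%E).
  apply: ge0_le_integral => //.
  - by move=> x _; rewrite lee_fin normal_pdf_ge0.
  - exact: measurable_funS mpdf.
  - move=> x /=; rewrite in_itv/= => /andP[x1 x2].
    rewrite lee_fin !normal_pdfE ?gt_eqF//.
    rewrite ler_wpM2l ?normal_peak_ge0// /normal_fun ler_expR !subr0 !mulNr lerN2.
    rewrite ler_wpM2r ?invr_ge0 ?mulrn_wge0 ?sqr_ge0//; nra.
apply: ge0_subset_integral => //.
- exact: measurable_funS mpdf.
- by move=> x _; rewrite lee_fin normal_pdf_ge0.
- by apply: subset_itv; rewrite // bnd_simp.
Qed.

(** The density is at least [exp (-1) / 2] on [[-1, 0]].  This positive number is
    the fraction of first-level energies retained in the lower bound. *)
Lemma laplace_neg_gt0 (R : realType) :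
  (0 < \int[lebesgue_measure]_(x in `]-oo, 0%R]) (2^-1 * expR (- `|x|))%:E :> \bar R)%E.
Proof.
have mdens : measurable_fun [set: R] (fun x : R => (2^-1 * expR (- `|x|))%:E).
  apply/measurable_EFinP; apply: measurable_funM => //.
  by apply: measurableT_comp => //; exact: measurableT_comp.
apply: (@lt_le_trans _ _ (\int[lebesgue_measure]_(x in `[(-1)%R, 0%R])
    (cst (2^-1 * expR (- 1))%:E x))%E).
  rewrite integral_cst//= lebesgue_measure_itv/= lte_fin ifT ?oppr_lt0//.
  by rewrite -EFinB -EFinM lte_fin opprK add0r mulr1 mulr_gt0 ?expR_gt0.
apply: (@le_trans _ _ (\int[lebesgue_measure]_(x in `[(-1)%R, 0%R])
    (2^-1 * expR (- `|x|))%:E)%E).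
  apply: ge0_le_integral => //.
  - by move=> x _; rewrite lee_fin mulr_ge0 ?expR_ge0.
  - exact: measurable_funS mdens.
  - move=> x /=; rewrite in_itv/= => /andP[x1 x2].
    by rewrite lee_fin ler_pM2l// ler_expR lerN2 ler_norml x1/= (le_trans x2).
apply: ge0_subset_integral => //.
- exact: measurable_funS mdens.
- by apply: subset_itv; rewrite // bnd_simp.
Qed.

(** * Second moment method *)

(** Chebyshev's inequality for the number of events that occur: if this number
    is at most half its mean [m], its squared deviation from [m] is at least
    [m^2 / 4].  Here [v] bounds the variance. *)
Lemma second_moment_le (d : measure_display) (T : measurableType d)
    (R : realType) (P : probability T R) (I : finType) (E : I -> set T)
    (m v : R) :
  (forall i, measurable (E i)) -> 0 < m ->
  (\sum_i P (E i) = m%:E)%E ->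
  (\sum_i \sum_j P (E i `&` E j) <= (m ^+ 2 + v)%:E)%E ->
  (P [set w | \sum_i \1_(E i) w <= m / 2]%R <= (4 * v / m ^+ 2)%:E)%E.
Proof.
move=> mE m0 Em Ev.
pose M w : R := \sum_i \1_(E i) w.
have mM : measurable_fun [set: T] M.
  by apply: measurable_sum => i; exact: measurable_indic.
have M0 w : 0 <= M w by apply: sumr_ge0.
have intM : (\int[P]_w (M w)%:E = m%:E)%E.
  rewrite -Em; under eq_integral do rewrite -sumEFin.
  rewrite ge0_integral_sum//=; last first.
    by move=> i; apply/measurable_EFinP; exact: measurable_indic.
  by apply: eq_bigr => i _; rewrite integral_indic// setIT.
have intMM : (\int[P]_w (M w ^+ 2)%:E <= (m ^+ 2 + v)%:E)%E.
  apply: le_trans Ev.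
  have MM w : (M w ^+ 2)%:E = (\sum_i \sum_j (\1_(E i `&` E j) w)%:E)%E.
    under eq_bigr do rewrite sumEFin.
    rewrite sumEFin; congr EFin.
    rewrite expr2 mulr_suml; apply: eq_bigr => i _.
    by rewrite mulr_sumr; apply: eq_bigr => j _; rewrite indicI.
  under eq_integral do rewrite MM.
  have mEE i j : measurable_fun [set: T] (fun w => (\1_(E i `&` E j) w)%:E : \bar R).
    by apply/measurable_EFinP; apply: measurable_indic; exact: measurableI.
  rewrite ge0_integral_sum//=; last 2 first.
  - by move=> i; exact: emeasurable_sum.
  - by move=> i w _; exact: sume_ge0.
  apply: lee_sum => i _; rewrite ge0_integral_sum//=.
  apply: lee_sum => j _; rewrite integral_indic ?setIT//; exact: measurableI.
pose Z w := (M w - m) ^+ 2.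
have mZ : measurable_fun [set: T] Z.
  by apply: measurable_funX; apply: measurable_funB.
have Z0 w : 0 <= Z w by exact: sqr_ge0.
(* The square is expanded with the cross term on the left, so that every
   integrand is nonnegative and no integrability has to be checked. *)
have intZ : (\int[P]_w (Z w)%:E <= v%:E)%E.
  have ZM : (\int[P]_w (Z w)%:E + (2 * m ^+ 2)%:E <= (2 * m ^+ 2 + v)%:E)%E.
    have -> : ((2 * m ^+ 2)%:E = \int[P]_w ((2 * m)%:E * (M w)%:E))%E.
      rewrite ge0_integralZl ?intM -?EFinM; first by congr EFin; ring.
      - by [].
      - exact/measurable_EFinP.
      - by move=> w _; rewrite lee_fin.
      - by rewrite lee_fin mulr_ge0// ltW.
    rewrite -ge0_integralD//; first last.
    - by apply: emeasurable_funM => //; exact/measurable_EFinP.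
    - by move=> w _; rewrite -EFinM lee_fin !mulr_ge0// ltW.
    - exact/measurable_EFinP.
    - by move=> w _; rewrite lee_fin.
    have -> : (\int[P]_w ((Z w)%:E + (2 * m)%:E * (M w)%:E)
        = \int[P]_w ((M w ^+ 2)%:E + (m ^+ 2)%:E))%E.
      apply: eq_integral => w _; rewrite -EFinM -!EFinD; congr EFin.
      by rewrite /Z; ring.
    rewrite ge0_integralD//; last 3 first.
    - by move=> w _; rewrite lee_fin sqr_ge0.
    - by apply/measurable_EFinP; exact: measurable_funX.
    - by move=> w _; rewrite lee_fin sqr_ge0.
    rewrite integral_cst//= probability_setT mule1.
    apply: (le_trans (leeD2r _ intMM)); rewrite -EFinD lee_fin; lra.
  move: ZM; rewrite -leeBrDr// -EFinB => /le_trans; apply.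
  by rewrite lee_fin; lra.
have m4 : 0 < m ^+ 2 / 4 by rewrite divr_gt0// exprn_gt0.
apply: (@le_trans _ _ (P [set w | m ^+ 2 / 4 <= Z w]%R)).
  apply: le_measure.
  - rewrite inE; have := mM measurableT `]-oo, (m / 2)]%classic (measurable_itv _).
    by rewrite setTI; congr measurable; apply/seteqP; split => w /=; rewrite in_itv.
  - rewrite inE; have := mZ measurableT `[m ^+ 2 / 4, +oo[%classic (measurable_itv _).
    by rewrite setTI; congr measurable; apply/seteqP; split => w /=;
      rewrite in_itv/= andbT.
  - by move=> w /=; rewrite -/(M w) /Z => Mm; nra.
apply: (le_trans (ge0_markov _ mZ Z0 m4)).
apply: (@le_trans _ _ ((m ^+ 2 / 4)^-1%:E * v%:E)%E).
  by rewrite lee_pmul2l// lte_fin invr_gt0.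
rewrite -EFinM [X in (X%:E <= _)%E](_ : _ = 4 * v / m ^+ 2)//.
by field; rewrite gt_eqF.
Qed.

(** * The model at fixed volume *)

Lemma card_spins (n : nat) : #|{: spins n}| = (2 ^ n)%N.
Proof. by rewrite card_ffun card_bool card_ord. Qed.

Lemma sum_eq_indicator (R : realType) (I : finType) (a : I) :
  \sum_i (a == i)%:R = 1 :> R.
Proof.
rewrite (bigD1 a)//= eqxx big1 ?addr0// => i /negbTE.
by rewrite eq_sym => ->.
Qed.

Section model.
Context (d : measure_display) (T : measurableType d) (R : realType)
  (P : probability T R) (n1 n2 : nat) (a1 a2 : R)
  (xi1 : spins n1 -> {RV P >-> R}) (xi2 : spins n1 -> spins n2 -> {RV P >-> R}).

Local Notation Z beta w := (partition_function a1 a2 xi1 xi2 beta w).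

Lemma partition_function_gt0 (beta : R) (w : T) : 0 < Z beta w.
Proof.
rewrite /partition_function (bigD1 ([ffun=> true], [ffun=> true]))//=.
by rewrite ltr_pwDl ?expR_gt0// sumr_ge0// => s _; exact: expR_ge0.
Qed.

(** For [p = beta / theta >= 1] this is the bound of the l^p norm of the weights
    [exp (- theta H)] by their l^1 norm. *)
Lemma ln_partition_function_le (theta beta : R) (w : T) :
  0 < theta -> theta <= beta ->
  ln (Z beta w) <= beta / theta * ln (Z theta w).
Proof.
move=> t0 tb; set L := ln (Z theta w); set r := beta / theta.
have r1 : 1 <= r by rewrite ler_pdivlMr// mul1r.
have ZL : Z theta w = expR L by rewrite lnK// posrE partition_function_gt0.
rewrite -ler_expR lnK ?posrE ?partition_function_gt0//.
have HL s : - theta * hamiltonian a1 a2 xi1 xi2 w s <= L.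
  rewrite -ler_expR -ZL /partition_function (bigD1 s)//= lerDl.
  by apply: sumr_ge0 => t _; exact: expR_ge0.
(* Each weight is at most [exp L], so its [r]-th power is at most itself times
   [exp ((r - 1) L)]. *)
have -> : expR (r * L) = Z theta w * expR ((r - 1) * L).
  by rewrite ZL -expRD; congr expR; ring.
rewrite /partition_function mulr_suml; apply: ler_sum => s _.
rewrite -expRD ler_expR.
have -> : - beta * hamiltonian a1 a2 xi1 xi2 w s =
    - theta * hamiltonian a1 a2 xi1 xi2 w s +
    (r - 1) * (- theta * hamiltonian a1 a2 xi1 xi2 w s).
  by rewrite /r; field; rewrite gt_eqF.
by rewrite lerD2l ler_wpM2l// subr_ge0.
Qed.

Definition level_event (A1 A2 : set R) (s : spins n1 * spins n2) : set T :=
  xi1 s.1 @^-1` A1 `&` xi2 s.1 s.2 @^-1` A2.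

Lemma measurable_level_event (A1 A2 : set R) s :
  measurable A1 -> measurable A2 -> measurable (level_event A1 A2 s).
Proof.
by move=> mA1 mA2; apply: measurableI; rewrite -[X in measurable X]setTI;
  apply: measurable_funPT.
Qed.

(** The sum counts configurations whose first-level energy only helps
    and whose second-level energy is at most [- a2 y]. *)
Lemma partition_function_ge (beta y : R) (w : T) :
  0 <= a1 -> 0 <= a2 -> 0 <= beta ->
  (\sum_s \1_(level_event `]-oo, 0] `]-oo, - y] s) w) * expR (beta * a2 * y)
    <= Z beta w.
Proof.
move=> a1_ge0 a2_ge0 b0; rewrite mulr_suml; apply: ler_sum => s _.
rewrite indicE; have [|_] := boolP (w \in _); last first.
  by rewrite mul0r expR_ge0.
rewrite inE /level_event /= !in_itv/= => -[x1 x2].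
rewrite mul1r ler_expR /hamiltonian mulNr mulrDr opprD.
have h1 : 0 <= - (beta * (a1 * xi1 s.1 w)).
  by rewrite oppr_ge0 mulr_ge0_le0// mulr_ge0_le0.
have h2 : beta * a2 * y <= - (beta * (a2 * xi2 s.1 s.2 w)).
  by rewrite mulrA -mulrN ler_wpM2l ?mulr_ge0// lerNr.
lra.
Qed.

Context (indep : mutually_independent (all_energies xi1 xi2)).

Lemma level_energies_indep s (A1 A2 : set R) : measurable A1 -> measurable A2 ->
  (P (level_event A1 A2 s) =
   P (xi1 s.1 @^-1` A1) * P (xi2 s.1 s.2 @^-1` A2))%E.
Proof.
move=> mA1 mA2.
pose A (i : spins n1 + spins n1 * spins n2) := if i is inl _ then A1 else A2.
have mA i : measurable (A i) by case: i.
have := indep (J := [set inl s.1; inr s]%SET) (A := A) (fun i _ => mA i).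
rewrite big_setU1 ?inE//= big_set1/= => <-; congr (P _).
apply/seteqP; split => [w [w1 w2] i /=|w h].
  by rewrite !inE => /orP[] /eqP ->.
by split; [apply: (h (inl s.1))|apply: (h (inr s))];
  rewrite /= !inE eqxx ?orbT.
Qed.

Lemma measurable_partition_function (beta : R) :
  measurable_fun [set: T] (fun w => Z beta w).
Proof.
apply: measurable_sum => s; apply: measurableT_comp => //.
apply: measurable_funM => //.
by apply: measurable_funD; apply: measurable_funM => //; exact: measurable_funPT.
Qed.

(** By linearity and the independence of the two energies of a single
    configuration; correlations between configurations do not enter. *)
Lemma expected_partition_function_le (theta v : R) :
  0 <= theta -> `|theta * a1| < 1 -> 0 < v ->
  (forall s1, has_density (xi1 s1) (fun x : R => 2^-1 * expR (- `|x|))) ->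
  (forall s1 s2, is_gaussian (xi2 s1 s2) 0 v) ->
  (\int[P]_w (Z theta w)%:E <=
   (2 ^+ (n1 + n2) * ((1 - `|theta * a1|)^-1
      * expR (2^-1 * (theta * a2) ^+ 2 * v)))%:E)%E.
Proof.
move=> t0 ta v0 law1 law2.
under eq_integral do rewrite -sumEFin.
rewrite ge0_integral_sum//=; last first.
  move=> s; apply/measurable_EFinP; apply: measurableT_comp => //.
  apply: measurable_funM => //.
  by apply: measurable_funD; apply: measurable_funM => //; exact: measurable_funPT.
apply: (@le_trans _ _ (\sum_(s : spins n1 * spins n2)
   ((1 - `|theta * a1|)^-1 * expR (2^-1 * (theta * a2) ^+ 2 * v))%:E)%E).
  apply: lee_sum => s _.
  have -> : (\int[P]_w (expR (- theta * hamiltonian a1 a2 xi1 xi2 w s))%:E =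
    \int[P]_w (expR (- (theta * a1) * xi1 s.1 w) *
      expR (- (theta * a2) * xi2 s.1 s.2 w))%:E)%E.
    apply: eq_integral => w _; rewrite -expRD; congr ((expR _)%:E).
    by rewrite /hamiltonian; ring.
  rewrite (@ge0_integral_indep _ _ _ P (xi1 s.1) (xi2 s.1 s.2)
    (fun x => expR (- (theta * a1) * x)) (fun x => expR (- (theta * a2) * x))); first last.
  - by move=> x; exact: expR_ge0.
  - by move=> x; exact: expR_ge0.
  - exact: measurable_expRM.
  - exact: measurable_expRM.
  - by move=> A B mA mB; exact: (level_energies_indep s).
  rewrite (gaussian_mgf _ v0 (law2 _ _)) EFinM sqrrN.
  rewrite lee_pmul2r ?lte_fin ?expR_gt0//.
  by rewrite -(normrN (theta * a1)); apply: laplace_mgf_le; rewrite ?normrN.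
rewrite sumEFin lee_fin sumr_const card_prod !card_spins.
by rewrite -expnD -[leLHS]mulr_natl natrX.
Qed.

(** Writing [N1] and [N2] for the numbers of configurations of the two blocks,
    two events factorize when the first blocks differ, have joint probability
    [b q^2] when only the second blocks differ, and coincide otherwise.  The
    variance is thus at most [N1 N2^2 b q^2 + N1 N2 b q], to be compared with
    the squared mean [(N1 N2 b q)^2]. *)
Lemma level_event_count_le (A1 A2 : set R) (b q : R) :
  measurable A1 -> measurable A2 -> 0 < b -> 0 < q ->
  (forall s1, P (xi1 s1 @^-1` A1) = b%:E) ->
  (forall s1 s2, P (xi2 s1 s2 @^-1` A2) = q%:E) ->
  (P [set w | \sum_s \1_(level_event A1 A2 s) w <= 2 ^+ (n1 + n2) * b * q / 2]%R
   <= (4 * ((2 ^+ n1 * b)^-1 + (2 ^+ (n1 + n2) * b * q)^-1))%:E)%E.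
Proof.
move=> mA1 mA2 b0 q0 Pb Pq.
set N1 : R := 2 ^+ n1; pose N2 : R := 2 ^+ n2.
have N1_gt0 : 0 < N1 by rewrite exprn_gt0.
have N2_gt0 : 0 < N2 by rewrite exprn_gt0.
rewrite exprD -/N1 -/N2.
have card1 : #|{: spins n1}|%:R = N1 by rewrite card_spins natrX.
have card2 : #|{: spins n2}|%:R = N2 by rewrite card_spins natrX.
have b2q2_ge0 : 0 <= b ^+ 2 * q ^+ 2 by rewrite mulr_ge0 ?sqr_ge0.
have bq2_ge0 : 0 <= b * q ^+ 2 by rewrite mulr_ge0 ?sqr_ge0// ltW.
have PE s : P (level_event A1 A2 s) = (b * q)%:E.
  by rewrite level_energies_indep// Pb Pq.
(* The three cases are merged into one upper bound that sums easily. *)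
have PEE s t : (P (level_event A1 A2 s `&` level_event A1 A2 t) <=
    (b ^+ 2 * q ^+ 2 + (s.1 == t.1)%:R * (b * q ^+ 2)
      + (s == t)%:R * (b * q))%:E)%E.
  have [<-|st] := eqVneq s t.
    rewrite setIid PE lee_fin eqxx !mul1r lerDr.
    by rewrite addr_ge0.
  pose A (i : spins n1 + spins n1 * spins n2) := if i is inl _ then A1 else A2.
  have mA i : measurable (A i) by case: i.
  pose J := [set inl s.1; inl t.1; inr s; inr t]%SET.
  have -> : level_event A1 A2 s `&` level_event A1 A2 t =
      \bigcap_(i in [set` J]) (all_energies xi1 xi2 i @^-1` A i).
    apply/seteqP; split => [w [[w1 w2] [w3 w4]] i /=|w h].
      by rewrite !inE -!orbA => /or4P[] /eqP ->.
    by split; split; [apply: (h (inl s.1))|apply: (h (inr s))|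
      apply: (h (inl t.1))|apply: (h (inr t))]; rewrite /= !inE eqxx ?orbT.
  rewrite indep// mul0r addr0.
  have -> : J = (inr s |: (inr t |: [set inl s.1; inl t.1]))%SET.
    by apply/setP => i; rewrite !inE; do 4 case: eqP => _.
  rewrite big_setU1/=; last by rewrite !inE/= orbF (inj_eq inr_inj).
  rewrite big_setU1/=; last by rewrite !inE.
  rewrite !Pq; have [<-|st1] := eqVneq s.1 t.1.
    rewrite finset.setUid big_set1/= Pb -!EFinM lee_fin mul1r.
    by rewrite [leLHS](_ : _ = b * q ^+ 2) ?lerDr//; ring.
  rewrite big_setU1/= ?inE ?(inj_eq inl_inj)// big_set1/= !Pb -!EFinM lee_fin.
  by rewrite mul0r addr0 [leLHS](_ : _ = b ^+ 2 * q ^+ 2)//; ring.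
have m0 : 0 < N1 * N2 * b * q by rewrite !mulr_gt0.
pose v := N1 * N2 ^+ 2 * (b * q ^+ 2) + N1 * N2 * (b * q).
have -> : 4 * ((N1 * b)^-1 + (N1 * N2 * b * q)^-1) = 4 * v / (N1 * N2 * b * q) ^+ 2.
  by rewrite /v; field; rewrite !gt_eqF.
apply: second_moment_le => //.
- by move=> s; exact: measurable_level_event.
- under eq_bigr do rewrite PE.
  rewrite sumEFin sumr_const card_prod -[_ *+ _]mulr_natl natrM card1 card2.
  by congr EFin; ring.
apply: (@le_trans _ _ (\sum_(s : spins n1 * spins n2) (N1 * N2 * (b ^+ 2 * q ^+ 2) + N2 * (b * q ^+ 2) + b * q)%:E)%E).
  apply: lee_sum => s _.
  apply: le_trans (lee_sum _ (fun t _ => PEE s t)) _.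
  rewrite sumEFin lee_fin !big_split/= sumr_const card_prod -[_ *+ _]mulr_natl natrM card1 card2.
  rewrite -!mulr_suml sum_eq_indicator mul1r.
  rewrite -(pair_big xpredT xpredT (fun i j => (s.1 == i)%:R))/=.
  under eq_bigr do rewrite sumr_const -[_ *+ _]mulr_natr card2.
  by rewrite -mulr_suml sum_eq_indicator mul1r.
rewrite sumEFin lee_fin sumr_const card_prod -[leLHS]mulr_natl natrM card1 card2.
by rewrite [leLHS](_ : _ = (N1 * N2 * b * q) ^+ 2 + v)// /v; ring.
Qed.

End model.

(** * Optimizing the parameters *)

(** Writing [s] for [sqrt (2 ln 2)], so that [ln 2 = s^2 / 2], the bound at
    [theta = (s / a2) (1 - delta)] equals [F (1 + delta^2 / (2 (1 - delta)))]
    with [F = beta a2 s]; this tends to [F] as [delta] vanishes.  The factor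
    [1 - delta] cannot be dropped: at the critical value [theta * a1] may
    be one, where the exponential moment of the first level is infinite. *)
Lemma limit_upper_param (R : realType) (a1 a2 beta eps : R) :
  0 < a1 -> 0 < a2 -> 0 < beta -> Num.sqrt (2 * ln 2) <= a2 / a1 -> 0 < eps ->
  exists theta, [/\ 0 < theta, theta <= beta, theta * a1 < 1 &
    beta / theta * (ln 2 + 2^-1 * (theta * a2) ^+ 2) <=
    (if beta <= Num.sqrt (2 * ln 2) / a2
     then ln 2 + 2^-1 * beta ^+ 2 * a2 ^+ 2
     else beta * a2 * Num.sqrt (2 * ln 2)) + eps].
Proof.
move=> a1_gt0 a2_gt0 b0; set s := Num.sqrt _ => ratio e0.
have ln2_gt0 : 0 < ln 2 :> R by rewrite ln_gt0// ltr1n.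
have s_gt0 : 0 < s by rewrite sqrtr_gt0 mulr_gt0.
have ln2E : ln 2 = s ^+ 2 / 2 by rewrite sqr_sqrtr ?mulr_ge0 ?ltW//; field.
have sa1 : s * a1 <= a2 by rewrite -ler_pdivlMr.
set F := (if _ then _ else _).
have [bs|bs] := ltP beta (s / a2).
  exists beta; split => //.
    rewrite -(ltr_pM2l a2_gt0) mulr1; move: bs; rewrite ltr_pdivlMr// => bs.
    by rewrite (lt_le_trans _ sa1)// mulrA ltr_pM2r// mulrC.
  by rewrite /F (ltW bs) divff ?gt_eqF// mul1r exprMn mulrA lerDl ltW.
have FE : F = beta * a2 * s.
  rewrite /F; case: ifPn => // bs'.
  have -> : beta = s / a2 by apply/eqP; rewrite eq_le bs bs'.
  by rewrite ln2E; field; rewrite gt_eqF.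
have F0 : 0 < F by rewrite FE !mulr_gt0.
pose delta := eps / (2 * (eps + F)).
have eF : 0 < 2 * (eps + F) by rewrite mulr_gt0// addr_gt0.
have d0 : 0 < delta by rewrite divr_gt0.
have d2 : delta <= 2^-1.
  by rewrite ler_pdivrMr// mulrA mulVf// mul1r lerDl ltW.
have Fd : F * delta <= eps.
  rewrite mulrA ler_pdivrMr//; nra.
have t0 : 0 < s / a2 * (1 - delta) by rewrite mulr_gt0 ?divr_gt0//; lra.
exists (s / a2 * (1 - delta)); split => //.
- by apply: le_trans bs; rewrite ler_piMr ?divr_ge0 ?ltW//; lra.
- apply: (@lt_le_trans _ _ (s / a2 * a1)).
    rewrite ltr_pM2r// -[ltRHS]mulr1 ltr_pM2l ?divr_gt0//; lra.
  by rewrite mulrAC ler_pdivrMr// mul1r.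
rewrite ln2E (_ : _ * _ = F + F * (delta ^+ 2 / (2 * (1 - delta)))); last first.
  rewrite FE; field; rewrite ?gt_eqF//; lra.
rewrite lerD2l; apply: le_trans Fd; rewrite ler_pM2l//.
rewrite ler_pdivrMr; last by lra.
nra.
Qed.

(** The function [y |-> ln 2 - y^2 / 2 + beta a2 y] is maximized over
    [0 < y < s], where [s] is [sqrt (2 ln 2)]: at [beta a2] if this is below
    [s], and in the limit at [s] otherwise. *)
Lemma limit_lower_param (R : realType) (a2 beta eps : R) :
  0 < a2 -> 0 < beta -> 0 < eps ->
  exists y, [/\ 0 < y, y ^+ 2 / 2 < ln 2 &
    (if beta <= Num.sqrt (2 * ln 2) / a2
     then ln 2 + 2^-1 * beta ^+ 2 * a2 ^+ 2
     else beta * a2 * Num.sqrt (2 * ln 2)) - eps <=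
    ln 2 - y ^+ 2 / 2 + beta * a2 * y].
Proof.
move=> a2_gt0 b0; set s := Num.sqrt _ => e0.
have ln2_gt0 : 0 < ln 2 :> R by rewrite ln_gt0// ltr1n.
have s_gt0 : 0 < s by rewrite sqrtr_gt0 mulr_gt0.
have ln2E : ln 2 = s ^+ 2 / 2 by rewrite sqr_sqrtr ?mulr_ge0 ?ltW//; field.
set F := (if _ then _ else _).
have ba0 : 0 < beta * a2 by rewrite mulr_gt0.
have [bs|bs] := ltP beta (s / a2).
  exists (beta * a2); split => //.
    have bas : beta * a2 < s by rewrite -ltr_pdivlMr.
    rewrite ln2E; nra.
  rewrite /F (ltW bs) exprMn; nra.
have FE : F = beta * a2 * s.
  rewrite /F; case: ifPn => // bs'.
  have -> : beta = s / a2 by apply/eqP; rewrite eq_le bs bs'.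
  by rewrite ln2E; field; rewrite gt_eqF.
have F0 : 0 < F by rewrite FE !mulr_gt0.
pose delta := eps / (eps + F).
have eF : 0 < eps + F by rewrite addr_gt0.
have d0 : 0 < delta by rewrite divr_gt0.
have d1 : delta < 1 by rewrite ltr_pdivrMr// mul1r ltrDl.
have Fd : F * delta <= eps.
  rewrite mulrA ler_pdivrMr//; nra.
have ys : (s * (1 - delta)) ^+ 2 / 2 < ln 2.
  rewrite ln2E; have : 0 < s ^+ 2 by rewrite exprn_gt0.
  nra.
exists (s * (1 - delta)); split => //.
  by rewrite mulr_gt0// subr_gt0.
rewrite mulrA -FE; lra.
Qed.

(** * Almost sure bounds in the limit *)

(** At the scale [y N] the variable of variance [N] has Gaussian cost
    [y^2 N / 2]; the prefactor of order [N^-1/2] and the shift by one in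
    [normal_prob_tail_ge] are absorbed by [delta]. *)
Lemma gaussian_tail_eventually (R : realType) (y delta : R) :
  0 <= y -> 0 < delta ->
  \forall N \near \oo,
    ((expR (- ((y ^+ 2 / 2 + delta) * N%:R)))%:E <=
     normal_prob 0 (Num.sqrt (N%:R : R)) `]-oo, (- (y * N%:R))%R])%E.
Proof.
move=> y0 d0; near=> N.
have N1 : 1 <= N%:R :> R by near: N; exact: nbhs_infty_ger.
have Ny : (y + 1) / (delta / 2) <= N%:R by near: N; exact: nbhs_infty_ger.
have Npi : 4 * pi / delta ^+ 2 <= N%:R by near: N; exact: nbhs_infty_ger.
have N0 : 0 < N%:R :> R by exact: lt_le_trans N1.
have s0 : 0 < Num.sqrt N%:R :> R by rewrite sqrtr_gt0.
have yN0 : 0 <= y * N%:R by rewrite mulr_ge0// ltW.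
apply: le_trans (normal_prob_tail_ge s0 yN0).
rewrite lee_fin normal_pdfE ?gt_eqF// /normal_peak /normal_fun.
rewrite !sqr_sqrtr ?(ltW N0)// subr0.
have peak : expR (- (delta / 2 * N%:R)) <= (Num.sqrt (N%:R * pi *+ 2))^-1.
  rewrite expRN lef_pV2 ?posrE ?expR_gt0 ?sqrtr_gt0 ?mulrn_wgt0 ?mulr_gt0 ?pi_gt0//.
  rewrite -(@ler_pXn2r _ 2) ?nnegrE ?sqrtr_ge0 ?expR_ge0//.
  rewrite sqr_sqrtr ?mulrn_wge0 ?mulr_ge0 ?pi_ge0 ?(ltW N0)//.
  rewrite -expRM_natr (_ : _ * 2 = delta * N%:R); last by field.
  have dN0 : 0 <= delta * N%:R by rewrite mulr_ge0 ?ltW.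
  apply: le_trans (expR_ge1Dxn 1 dN0).
  move: Npi; rewrite ler_pdivrMr ?exprn_gt0// => Npi.
  have h : 4 * pi * N%:R <= N%:R * delta ^+ 2 * N%:R by rewrite ler_pM2r.
  have -> : (2`!%:R : R) = 2 by [].
  rewrite exprMn mulr2n; lra.
apply: le_trans (ler_pM (expR_ge0 _) (expR_ge0 _) peak (lexx _)).
rewrite -expRD ler_expR.
move: Ny; rewrite ler_pdivrMr ?divr_gt0// => Ny.
have -> : - (y * N%:R + 1) ^+ 2 / (N%:R *+ 2) = - (y ^+ 2 / 2 * N%:R + y + (N%:R)^-1 / 2).
  by rewrite -(mulr_natr N%:R 2); field; rewrite gt_eqF.
have : N%:R^-1 <= 1 :> R by rewrite invf_le1.
lra.
Unshelve. all: by end_near. Qed.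

Lemma pow2_expR (R : realType) (n : nat) : 2 ^+ n = expR (n%:R * ln 2) :> R.
Proof. by rewrite expRM_natl lnK// posrE. Qed.

Section thermodynamic_limit.
Context (R : realType) (d : measure_display) (T : measurableType d)
  (P : probability T R) (k1 k2 : nat -> nat) (p1 a1 a2 beta : R)
  (xi1 : forall N : nat, spins (k1 N) -> {RV P >-> R})
  (xi2 : forall N : nat, spins (k1 N) -> spins (k2 N) -> {RV P >-> R}).
Context (k_sum : forall N : nat, (2 <= N)%N -> (k1 N + k2 N = N)%N)
  (k1_cvg : (fun N : nat => (k1 N)%:R / N%:R : R) @ \oo --> p1)
  (p1_gt0 : 0 < p1)
  (a1_gt0 : 0 < a1) (a2_gt0 : 0 < a2) (beta_gt0 : 0 < beta)
  (xi_indep : forall N : nat, (2 <= N)%N ->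
     mutually_independent (all_energies (@xi1 N) (@xi2 N)))
  (xi1_law : forall N : nat, (2 <= N)%N -> forall s1 : spins (k1 N),
     has_density (xi1 s1) (fun x : R => 2^-1 * expR (- `|x|)))
  (xi2_law : forall N : nat, (2 <= N)%N ->
     forall (s1 : spins (k1 N)) (s2 : spins (k2 N)),
     is_gaussian (xi2 s1 s2) 0 N%:R).

Local Notation Z beta N w :=
  (partition_function a1 a2 (@xi1 N) (@xi2 N) beta w).

(** Markov's inequality loses a factor [exp (eps N)], whose inverse is summable,
    at [theta]; the bound is then transferred to [beta]. *)
Lemma ae_pressure_le (theta eps : R) :
  0 < theta -> theta <= beta -> theta * a1 < 1 -> 0 < eps ->
  {ae P, forall w, \forall N \near \oo,
    N%:R^-1 * ln (Z beta N w) <=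
    beta / theta * (ln 2 + 2^-1 * (theta * a2) ^+ 2 + eps)}.
Proof.
move=> t0 tb ta1 e0.
pose f := ln 2 + 2^-1 * (theta * a2) ^+ 2.
pose F N := [set w | expR (N%:R * (f + eps)) <= Z theta N w].
have ta0 : 0 < theta * a1 by rewrite mulr_gt0.
pose C := (1 - `|theta * a1|)^-1.
have C0 : 0 <= C by rewrite invr_ge0 subr_ge0 gtr0_norm// ltW.
have mZ N : measurable_fun [set: T] (fun w => Z theta N w).
  exact: measurable_partition_function.
have mF N : measurable (F N).
  have := mZ N measurableT `[expR (N%:R * (f + eps)), +oo[%classic (measurable_itv _).
  rewrite setTI; congr measurable; apply/seteqP.
  by split => w /=; rewrite in_itv/= andbT.
have : {ae P, forall w, \forall N \near \oo, ~ F N w}.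
  apply: (@ae_eventually_notin _ _ _ P F C eps) => //.
  near=> N.
  have N2 : (2 <= N)%N by near: N; exact: nbhs_infty_ge.
  have N0 : 0 < N%:R :> R by rewrite ltr0n (leq_trans _ N2).
  apply: le_trans (ge0_markov P (mZ N) _ (expR_gt0 _)) _.
    by move=> w; rewrite ltW// partition_function_gt0.
  have := expected_partition_function_le a2 (xi_indep N2) (ltW t0) _ N0 (xi1_law N2) (xi2_law N2).
  move=> /(_ a1); rewrite gtr0_norm// => /(_ ta1) EZ.
  apply: (@le_trans _ _ ((expR (N%:R * (f + eps)))^-1%:E * (2 ^+ (k1 N + k2 N) *
      (C * expR (2^-1 * (theta * a2) ^+ 2 * N%:R)))%:E)%E).
    by rewrite lee_pmul2l ?lte_fin ?invr_gt0 ?expR_gt0// /C gtr0_norm.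
  rewrite k_sum// -EFinM lee_fin -expRN pow2_expR.
  rewrite [leLHS](_ : _ = C * (expR (- (N%:R * (f + eps))) * (expR (N%:R * ln 2)
    * expR (2^-1 * (theta * a2) ^+ 2 * N%:R)))); last by ring.
  by rewrite -!expRD ler_wpM2l// ler_expR /f [leLHS](_ : _ = - (eps * N%:R))//; ring.
apply: filterS => w; apply: filterS2 (nbhs_infty_ge 1%N) => N N1 /negP.
rewrite -ltNge => ZN.
have N0 : 0 < N%:R :> R by rewrite ltr0n.
rewrite ler_pdivrMl//; apply: (le_trans (ln_partition_function_le _ _ _ _ _ t0 tb)).
rewrite [leRHS]mulrCA ler_pM2l ?divr_gt0 ?(lt_le_trans t0)//.
by rewrite -ler_expR lnK ?posrE ?partition_function_gt0// ltW.
Unshelve. all: by end_near. Qed.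

(** The number of configurations counted in [partition_function_ge] exceeds half
    its mean for all large [N], almost surely. *)
Lemma ae_pressure_ge (y eps : R) : 0 < y -> y ^+ 2 / 2 < ln 2 -> 0 < eps ->
  {ae P, forall w, \forall N \near \oo,
    ln 2 - y ^+ 2 / 2 + beta * a2 * y - eps <= N%:R^-1 * ln (Z beta N w)}.
Proof.
move=> y0 yln2 e0.
pose h := ln 2 - y ^+ 2 / 2.
have h0 : 0 < h by rewrite subr_gt0.
(* [delta <= h / 2] keeps the mean number of counted configurations
   exponentially large; [delta <= eps / 2] leaves half of the error for the
   constant factor [b / 2]. *)
pose delta := Num.min (eps / 2) (h / 2).
have d0 : 0 < delta by rewrite lt_min !divr_gt0.
have de : delta <= eps / 2 by rewrite ge_min lexx.
have dh : delta <= h / 2 by rewrite ge_min lexx orbT.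
have ln2_gt0 : 0 < ln 2 :> R by rewrite ln_gt0// ltr1n.
pose b : R := fine (\int[lebesgue_measure]_(x in `]-oo, 0%R]) (2^-1 * expR (- `|x|))%:E)%E.
pose q N : R := fine (normal_prob 0 (Num.sqrt (N%:R : R)) `]-oo, (- (y * N%:R))%R]).
have qE N : normal_prob 0 (Num.sqrt (N%:R : R)) `]-oo, (- (y * N%:R))%R] = (q N)%:E.
  by rewrite /q fineK// fin_num_measure.
have Pb N (s1 : spins (k1 N)) : (2 <= N)%N ->
    P (@xi1 N s1 @^-1` `]-oo, 0]) = b%:E.
  move=> N2; rewrite -[LHS]fineK ?fin_num_measure//.
    by rewrite /b -(xi1_law N2 s1).
  by rewrite -[X in measurable X]setTI; exact: measurable_funPT.
have b0 : 0 < b.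
  have s1 : spins (k1 2) := [ffun=> true].
  rewrite -lte_fin -(Pb 2%N s1)//; have := laplace_neg_gt0 R.
  by rewrite -(xi1_law (leqnn 2) s1).
have Pq N (s1 : spins (k1 N)) (s2 : spins (k2 N)) : (2 <= N)%N ->
    P (@xi2 N s1 s2 @^-1` `]-oo, - (y * N%:R)]) = (q N)%:E.
  by move=> N2; rewrite -qE -(xi2_law N2 s1 s2).
pose E N := level_event (@xi1 N) (@xi2 N) `]-oo, 0] `]-oo, - (y * N%:R)].
pose F N := [set w | \sum_s \1_(E N s) w <= 2 ^+ (k1 N + k2 N) * b * q N / 2].
have mF N : measurable (F N).
  have mM : measurable_fun [set: T] (fun w => \sum_s \1_(E N s) w : R).
    apply: measurable_sum => s; apply: measurable_indic.
    exact: measurable_level_event.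
  have := mM measurableT `]-oo, (2 ^+ (k1 N + k2 N) * b * q N / 2)]%classic
    (measurable_itv _).
  by rewrite setTI; congr measurable; apply/seteqP; split => w /=; rewrite in_itv.
(* The two terms of the relative variance decay at the rates [p1 ln 2] and
   [h - delta]; the first is halved because [k1 N / N] only tends to [p1]. *)
pose c := Num.min (p1 / 2 * ln 2) (h - delta).
have c0 : 0 < c.
  by rewrite lt_min mulr_gt0 ?divr_gt0//= subr_gt0; lra.
have q_ge : \forall N \near \oo, expR (- ((y ^+ 2 / 2 + delta) * N%:R)) <= q N.
  have := gaussian_tail_eventually (ltW y0) d0.
  by apply: filterS => N; rewrite qE lee_fin.
have q2_ge : \forall N \near \oo, expR (N%:R * (h - delta)) <= 2 ^+ N * q N.
  apply: filterS q_ge => N qN.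
  rewrite (_ : _ * _ = N%:R * ln 2 + - ((y ^+ 2 / 2 + delta) * N%:R)).
    by rewrite expRD -pow2_expR ler_pM2l ?exprn_gt0.
  by rewrite /h; ring.
have : {ae P, forall w, \forall N \near \oo, ~ F N w}.
  apply: (@ae_eventually_notin _ _ _ P F (8 / b) c) => //.
    by rewrite divr_ge0// ltW.
  near=> N.
  have N2 : (2 <= N)%N by near: N; exact: nbhs_infty_ge.
  have N0 : 0 < N%:R :> R by rewrite ltr0n (leq_trans _ N2).
  have q2 : expR (N%:R * (h - delta)) <= 2 ^+ N * q N by near: N.
  have q0 : 0 < q N.
    by rewrite -(pmulr_rgt0 _ (exprn_gt0 N (ltr0Sn R 1))) (lt_le_trans _ q2)// expR_gt0.
  have k1N : p1 / 2 * N%:R <= (k1 N)%:R.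
    rewrite -ler_pdivlMr//; near: N.
    by apply: (cvgr_ge _ k1_cvg); rewrite ltr_pdivrMr// ltr_pMr// ltr1n.
  apply: (le_trans (level_event_count_le (xi_indep N2) _ _ b0 q0 _ _)) => //.
  - by move=> s1; exact: Pb.
  - by move=> s1 s2; exact: Pq.
  rewrite k_sum// lee_fin.
  have cN1 : expR (c * N%:R) <= 2 ^+ k1 N.
    rewrite pow2_expR ler_expR.
    have : c * N%:R <= p1 / 2 * ln 2 * N%:R by rewrite ler_pM2r// ge_min lexx.
    move=> /le_trans; apply; rewrite mulrAC ler_pM2r//.
  have cN2 : expR (c * N%:R) <= 2 ^+ N * q N.
    apply: le_trans q2; rewrite ler_expR mulrC ler_pM2l//.
    by rewrite ge_min lexx orbT.
  rewrite expRN.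
  have e1 : (2 ^+ k1 N)^-1 <= (expR (c * N%:R))^-1 by rewrite lef_pV2 ?posrE ?exprn_gt0 ?expR_gt0.
  have e2 : (2 ^+ N * q N)^-1 <= (expR (c * N%:R))^-1.
    by rewrite lef_pV2 ?posrE ?mulr_gt0 ?exprn_gt0 ?expR_gt0.
  rewrite (_ : _ + _ = b^-1 * ((2 ^+ k1 N)^-1 + (2 ^+ N * q N)^-1)); last first.
    by rewrite !invfM; ring.
  rewrite (_ : 8 / b * _ = 4 * (b^-1 * ((expR (c * N%:R))^-1 + (expR (c * N%:R))^-1))); last by ring.
  by rewrite ler_pM2l// ler_pM2l ?invr_gt0// lerD.
apply: filterS => w wF; near=> N.
have N2 : (2 <= N)%N by near: N; exact: nbhs_infty_ge.
have N0 : 0 < N%:R :> R by rewrite ltr0n (leq_trans _ N2).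
have q2 : expR (N%:R * (h - delta)) <= 2 ^+ N * q N by near: N.
have bN : - ln (b / 2) / delta <= N%:R by near: N; exact: nbhs_infty_ger.
have /negP : ~ F N w by near: N.
rewrite -ltNge k_sum// => MN.
rewrite ler_pdivlMl// -ler_expR lnK ?posrE ?partition_function_gt0//.
have Zge := partition_function_ge (@xi1 N) (@xi2 N) (y * N%:R) w
  (ltW a1_gt0) (ltW a2_gt0) (ltW beta_gt0).
apply: (le_trans _ Zge).
apply: (@le_trans _ _ (2 ^+ N * b * q N / 2 * expR (beta * a2 * (y * N%:R)))); last first.
  by rewrite ler_pM2r ?expR_gt0// ltW.
apply: (@le_trans _ _ (expR (N%:R * (h - delta)) * expR (ln (b / 2)) *
    expR (beta * a2 * (y * N%:R)))).
  rewrite -!expRD ler_expR.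
  move: bN; rewrite ler_pdivrMr// => bN.
  have : N%:R * delta <= N%:R * (eps / 2) by rewrite ler_pM2l.
  rewrite -/h; lra.
rewrite ler_pM2r ?expR_gt0// lnK ?posrE ?divr_gt0//.
rewrite (_ : 2 ^+ N * b * q N / 2 = 2 ^+ N * q N * (b / 2)); last by ring.
by rewrite ler_pM2r ?divr_gt0.
Unshelve. all: by end_near. Qed.

End thermodynamic_limit.

Unset Implicit Arguments.

Theorem theorem2p7p3 (R : realType) (d : measure_display)
    (T : measurableType d) (P : probability T R)
    (k1 k2 : nat -> nat) (p1 p2 a1 a2 beta : R)
    (xi1 : forall N : nat, spins (k1 N) -> {RV P >-> R})
    (xi2 : forall N : nat, spins (k1 N) -> spins (k2 N) -> {RV P >-> R})
    (k1_ge1 : forall N : nat, (2 <= N)%N -> (1 <= k1 N)%N)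
    (k2_ge1 : forall N : nat, (2 <= N)%N -> (1 <= k2 N)%N)
    (k_sum : forall N : nat, (2 <= N)%N -> (k1 N + k2 N = N)%N)
    (k1_cvg : (fun N : nat => (k1 N)%:R / N%:R : R) @ \oo --> p1)
    (k2_cvg : (fun N : nat => (k2 N)%:R / N%:R : R) @ \oo --> p2)
    (p1_gt0 : 0 < p1) (p2_gt0 : 0 < p2)
    (a1_gt0 : 0 < a1) (a2_gt0 : 0 < a2) (beta_gt0 : 0 < beta)
    (xi_indep : forall N : nat, (2 <= N)%N ->
       mutually_independent (all_energies (xi1 N) (xi2 N)))
    (xi1_law : forall N : nat, (2 <= N)%N -> forall s1 : spins (k1 N),
       has_density (xi1 N s1) (fun x : R => 2^-1 * expR (- `|x|)))
    (xi2_law : forall N : nat, (2 <= N)%N ->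
       forall (s1 : spins (k1 N)) (s2 : spins (k2 N)),
       is_gaussian (xi2 N s1 s2) 0 N%:R)
    (a_ratio : Num.sqrt (2 * ln 2) <= a2 / a1) :
  {ae P, forall w : T,
    (fun N : nat =>
       N%:R^-1 * ln (partition_function a1 a2 (xi1 N) (xi2 N) beta w))
      @ \oo -->
    (if beta <= Num.sqrt (2 * ln 2) / a2
     then ln 2 + 2^-1 * beta ^+ 2 * a2 ^+ 2
     else beta * a2 * Num.sqrt (2 * ln 2))}.
Proof.
set L := (if _ then _ else _).
set u := fun w N => N%:R^-1 * ln (partition_function a1 a2 (xi1 N) (xi2 N) beta w).
have inv_gt0 n : 0 < n.+1%:R^-1 :> R by rewrite invr_gt0.
have upper n : {ae P, forall w, \forall N \near \oo, u w N <= L + n.+1%:R^-1}.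
  have half_gt0 : 0 < n.+1%:R^-1 / 2 :> R by rewrite divr_gt0.
  have [theta [t0 tb ta1 Lt]] :=
    limit_upper_param a1_gt0 a2_gt0 beta_gt0 a_ratio half_gt0.
  (* The slack is scaled so that the factor beta / theta turns it into half
     of the allowed error. *)
  have slack_gt0 : 0 < theta / beta * (n.+1%:R^-1 / 2).
    by rewrite mulr_gt0// divr_gt0.
  have := ae_pressure_le a2 k_sum a1_gt0 xi_indep xi1_law xi2_law t0 tb ta1 slack_gt0.
  apply: filterS => w; apply: filterS => N /le_trans; apply.
  rewrite mulrDr [X in _ + X](_ : _ = n.+1%:R^-1 / 2); last first.
    by field; rewrite !gt_eqF//= ltr0n.
  by rewrite [in leRHS](splitr n.+1%:R^-1) addrA lerD2r.
have lower n : {ae P, forall w, \forall N \near \oo, L - n.+1%:R^-1 <= u w N}.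
  have half_gt0 : 0 < n.+1%:R^-1 / 2 :> R by rewrite divr_gt0.
  have [y [y0 yln2 Ly]] := limit_lower_param a2_gt0 beta_gt0 half_gt0.
  have := ae_pressure_ge k_sum k1_cvg p1_gt0 a1_gt0 a2_gt0 beta_gt0 xi_indep
    xi1_law xi2_law y0 yln2 half_gt0.
  apply: filterS => w; apply: filterS => N; apply: le_trans.
  by rewrite [in leLHS](splitr n.+1%:R^-1) opprD addrA lerD2r.
apply: filterS2 (ae_foralln upper) (ae_foralln lower) => w up lo.
apply/cvgrPdist_le => e e0.
have [n] := ltr_add_invr e0; rewrite add0r => ne.
apply: filterS2 (up n) (lo n) => N uN lN.
rewrite ler_distl lerBlDr; apply/andP; split.
  by apply: (le_trans uN); rewrite lerD2l ltW.
by move: lN; rewrite lerBlDr => /le_trans; apply; rewrite lerD2l ltW.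
Qed.
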